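(* Let $X$ be a Banach space, $(R,r)$ a subsequential space on $X$, and $s$ a bimonotone norm on $c_{00}(X)$ with natural domain $S$. The following are equivalent. (1) Every member of $R$ has a subsequence which is a member of $S$. (2) For any $\varsigma\in R$, there exist a constant $C$ and a subsequence $\varrho$ of $\varsigma$ such that every subsequence of $\varrho$ lies in $CB_S$. (3) There exists a constant $C$ such that for every $\varsigma\in B_R$, there exists a subsequence $\varrho$ of $\varsigma$ such that every subsequence of $\varrho$ lies in $CB_S$.
   Context: $\mathbb{N}=\{1,2,\ldots\}$. For a Banach space $X$, $\ell_\infty(X)$ is the space of bounded sequences in $X$ with the sup norm. For $x\in X$, $n\in\mathbb{N}$, $x\otimes e_n$ is the sequence with $n$-th term $x$ and all other terms $0$; $\sum_n x_n\otimes e_n$ denotes the sequence $(x_1,x_2,\ldots)$; $c_{00}(X)$ is the span of all $x\otimes e_n$. For a normed space $(Z,\|\cdot\|)$, $B_Z$ is the closed unit ball. Subsequential space: a Banach space $(R,r)$ with $c_{00}(X)\subset R\subset\ell_\infty(X)$ (a linear subspace, not necessarily closed in $\ell_\infty(X)$) is a subsequential space on $X$ if, with $B_R=\{\varsigma\in R: r(\varsigma)\leqslant 1\}$, (i) $B_R\subset B_{\ell_\infty(X)}$, and (ii) if $\varsigma\in B_R$, every subsequence of $\varsigma$ is in $B_R$. Bimonotone norm: a norm $s$ on $c_{00}(X)$ is bimonotone if (i) $s(x\otimes e_n)=\|x\|$ for all $x\in X$, $n\in\mathbb{N}$, and (ii) for $\varsigma=(x_n)_{n=1}^\infty\in c_{00}(X)$,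 $s(\varsigma)=\sup_{l\leqslant m}s(\sum_{n=l}^m x_n\otimes e_n)=\lim_m s(\sum_{n=1}^m x_n\otimes e_n)$. Its natural domain $S$ is the space of all $(x_n)_{n=1}^\infty\in\ell_\infty(X)$ with $\sup_m s(\sum_{n=1}^m x_n\otimes e_n)<\infty$, and $s$ is extended to $S$ by $s((x_n)_{n=1}^\infty)=\sup_m s(\sum_{n=1}^m x_n\otimes e_n)$. Then $CB_S=\{\varsigma\in S: s(\varsigma)\leqslant C\}$. *)

(* Defs.v *)
From HB Require Import structures.
From mathcomp Require Import all_boot all_order all_algebra.
From mathcomp Require Import all_classical all_reals all_analysis.

Set Implicit Arguments.
Unset Strict Implicit.
Unset Printing Implicit Defensive.

Import Order.TTheory GRing.Theory Num.Theory.
Import numFieldNormedType.Exports.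

Local Open Scope classical_set_scope.
Local Open Scope ring_scope.

(* Sequences are indexed from 0: term n here is term n + 1 of a sequence
   indexed by the positive integers.  A subspace is a set of sequences, and
   a norm on it is a total function of which only the values there matter. *)

Section NormedSubspace.
Variables (K : realType) (V : lmodType K).

Record is_norm_on (A : set V) (N : V -> K) : Prop := IsNormOn {
  norm_on_ge0 : forall v, A v -> 0 <= N v;
  norm_on_eq0 : forall v, A v -> N v = 0 -> v = 0;
  norm_onZ : forall (a : K) v, A v -> N (a *: v) = `|a| * N v;
  norm_onD : forall v w, A v -> A w -> N (v + w) <= N v + N w }.

Definition complete_on (A : set V) (N : V -> K) : Prop :=
  forall u : nat -> V, (forall n, A (u n)) ->
    (forall e : K, 0 < e -> exists n0 : nat, forall m n : nat,
        (n0 <= m)%N -> (n0 <= n)%N -> N (u m - u n) < e) ->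
    exists2 v, A v & N (u n - v) @[n --> \oo] --> (0 : K).

Record banach_subspace (A : set V) (N : V -> K) : Prop := BanachSubspace {
  banach_submod : submod_closed (mem A);
  banach_norm : is_norm_on A N;
  banach_complete : complete_on A N }.

Definition closed_ball_on (A : set V) (N : V -> K) (C : K) : set V :=
  [set v | A v /\ N v <= C].

Definition linear_span (G : set V) : set V :=
  smallest (fun A : set V => submod_closed (mem A)) G.

End NormedSubspace.

Definition subsequence (T : Type) (tau sigma : nat -> T) : Prop :=
  exists2 phi : nat -> nat, increasing_seq phi & tau = sigma \o phi.

Section SequenceSpaces.
Variables (K : realType) (X : completeNormedModType K).
Implicit Types (sigma : nat -> X) (R : set (nat -> X)) (r s : (nat -> X) -> K).

(* x (x) e_n *)
Definition tensor (x : X) (n : nat) : nat -> X :=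
  fun k => if k == n then x else 0.

Definition c00 : set (nat -> X) :=
  linear_span [set tensor p.1 p.2 | p in [set: X * nat]].

Definition linf : set (nat -> X) := [set sigma | bounded_fun sigma].

Definition linf_norm sigma : K := sup [set `|sigma n| | n in [set: nat]].

Record subsequential_space R r : Prop := SubsequentialSpace {
  subseq_banach : banach_subspace R r;
  subseq_c00 : c00 `<=` R;
  subseq_linf : R `<=` linf;
  subseq_ball : closed_ball_on R r 1 `<=` closed_ball_on linf linf_norm 1;
  subseq_stable : forall sigma tau,
    closed_ball_on R r 1 sigma -> subsequence tau sigma ->
    closed_ball_on R r 1 tau }.

(* both ends l and m are included *)
Definition block (l m : nat) sigma : nat -> X :=
  \sum_(l <= n < m.+1) tensor (sigma n) n.

Record bimonotone_norm s : Prop := BimonotoneNorm {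
  bimonotone_is_norm : is_norm_on c00 s;
  bimonotone_tensor : forall (x : X) (n : nat), s (tensor x n) = `|x|;
  bimonotone_sup : forall sigma, c00 sigma ->
    (s sigma)%:E = ereal_sup
      [set (s (block p.1 p.2 sigma))%:E | p in [set p | (p.1 <= p.2)%N]];
  bimonotone_lim : forall sigma, c00 sigma ->
    s (block 0 m sigma) @[m --> \oo] --> s sigma }.

Definition natural_domain s : set (nat -> X) :=
  [set sigma | linf sigma /\
    has_ubound [set s (block 0 m sigma) | m in [set: nat]]].

Definition natural_ext s sigma : K :=
  sup [set s (block 0 m sigma) | m in [set: nat]].

End SequenceSpaces.

(* Main.v *)
(* Fix a free ultrafilter [U] on the indices. For a well-founded tree [B] let
   [p_B sigma] be the [U]-limit, iterated along [B], of [s] of the finite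
   pieces [(sigma i_1, .., sigma i_k)]. If no [p_B sigma] exceeds [C], a
   diagonal argument gives a subsequence of [sigma] all of whose subsequences
   lie in [C B_S]; if the [p_B sigma] are unbounded, it gives a subsequence none
   of whose subsequences is in [S]. Under (1) the seminorms [p_B] are therefore
   pointwise bounded on [R]. They are also continuous on [R], by induction on
   [B]: one node of [B] is a limit of seminorms which are continuous by
   induction and pointwise bounded, hence equicontinuous by Banach-Steinhaus.
   Banach-Steinhaus for the family of all [p_B] then gives (3). *)
Require Import Defs.
From HB Require Import structures.
From mathcomp Require Import all_boot all_order all_algebra.
From mathcomp Require Import all_classical all_reals all_analysis.
From mathcomp Require Import ring lra.

Set Implicit Arguments.
Unset Strict Implicit.
Unset Printing Implicit Defensive.

Import Order.TTheory GRing.Theory Num.Theory.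
Import numFieldNormedType.Exports.
Local Open Scope classical_set_scope.
Local Open Scope ring_scope.

(** * Increasing sequences and diagonalisation along a free ultrafilter *)

Lemma increasing_seq_comp (f g : nat -> nat) :
  increasing_seq f -> increasing_seq g -> increasing_seq (f \o g).
Proof. by move=> f_incr g_incr m n /=; rewrite f_incr; exact: g_incr. Qed.

Lemma increasing_seq_ge_id (f : nat -> nat) (n : nat) :
  increasing_seq f -> (n <= f n)%N.
Proof.
move=> /increasing_seqP f_lt; elim: n => // n IHn.
exact: leq_ltn_trans IHn (f_lt n).
Qed.

Lemma free_ultrafilter :
  exists2 U : set_system nat, UltraFilter U & forall k, U [set n | (k <= n)%N].
Proof.
have [U [U_ultra ooU]] := @ultraFilterLemma nat \oo _.
by exists U => // k; apply: ooU; exact: nbhs_infty_ge.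
Qed.

(** Each [f j.+1] is chosen in [D F] for all of the finitely many [F] of length at most [(f j).+1]
    with entries at most [f j]; hence every [g] is served at once. *)
Lemma ultra_diagonal (U : set_system nat) (D : seq nat -> set nat) :
    UltraFilter U -> (forall k, U [set n | (k <= n)%N]) -> (forall F, U (D F)) ->
  exists2 f : nat -> nat, increasing_seq f &
    forall g, increasing_seq g -> forall i, D (mkseq (f \o g) i) (f (g i)).
Proof.
move=> U_ultra U_free UD.
have stage k : exists n : nat, (k <= n)%N /\
    forall F : seq nat, (size F <= k)%N -> all (gtn k) F -> D F n.
  have : U [set n | forall (j : 'I_k.+1) (F : {ffun 'I_j -> 'I_k}),
      D [seq val (F i) | i <- enum 'I_j] n].
    by apply: filter_forall => j; apply: filter_forall => F; exact: UD.
  move=> /(filterI (U_free k)) /filter_ex [n [kn Dn]].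
  exists n; split=> // F sF aF.
  have lF (i : 'I_(size F)) : (nth 0 F i < k)%N by apply: (allP aF); apply: mem_nth.
  have := Dn (Ordinal (sF : (size F < k.+1)%N)) [ffun i => Ordinal (lF i)].
  rewrite /=; congr (D _ n); rewrite -[RHS](mkseq_nth 0) /mkseq -val_enum_ord -map_comp.
  by apply: eq_map => i /=; rewrite ffunE.
have [next nextP] := choice stage.
pose f := fix f j := if j is j'.+1 then next (f j').+1 else next 0%N.
have f_incr : increasing_seq f.
  by apply/increasing_seqP => j; exact: (nextP (f j).+1).1.
exists f => // g g_incr i.
have := increasing_seq_ge_id i g_incr.
(* [g i = 0] forces [i = 0], so the list is empty, which the choice [next 0] covers. *)
case gi: (g i) => [|j] ij.
  by move: ij; rewrite leqn0 => /eqP ->; apply: (nextP 0%N).2.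
apply: (nextP (f j).+1).2; rewrite ?size_mkseq.
  by rewrite (leq_trans ij)// ltnS increasing_seq_ge_id.
apply/allP => _ /mapP[k + ->]; rewrite mem_iota add0n => /= ki.
rewrite /= ltnS -leEnat f_incr -ltnS -gi ltnNge.
by have := g_incr i k; rewrite leEnat => ->; rewrite -ltnNge.
Qed.

(** * Trees and iterated ultrafilter limits *)

Inductive tree := Leaf | Node of nat -> tree.

Section Exceeds.
Variables (K : realType) (U : set_system nat).

(* The tree tells how many further terms are read, depending on the terms
   already read: [exceeds f B F C] says that the [U]-limit, iterated along [B],
   of the values of [f] at the extensions of [F] is larger than [C]. *)
Fixpoint exceeds (f : seq nat -> K) (B : tree) (F : seq nat) (C : K) : Prop :=
  if B is Node b then U [set n | exceeds f (b n) (rcons F n) C] else C < f F.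

Context {U_ultra : UltraFilter U}.

Lemma exceeds_shift (f g : seq nat -> K) (B : tree) (F G : seq nat) (C d : K) :
  (forall H, f (F ++ H) <= g (G ++ H) + d) ->
  exceeds f B F (C + d) -> exceeds g B G C.
Proof.
elim: B F G => [|b IHb] F G /= fg.
  by move=> Cf; have := fg [::]; rewrite !cats0; lra.
apply: filterS => n; apply: IHb => H.
by rewrite !cat_rcons.
Qed.

Lemma exceeds_le (f : seq nat -> K) (B : tree) (F : seq nat) (C C' : K) :
  C' <= C -> exceeds f B F C -> exceeds f B F C'.
Proof.
move=> CC' fC; apply: (@exceeds_shift f f B F F C' (C - C')).
  by move=> H; rewrite lerDl subr_ge0.
by rewrite addrC subrK.
Qed.

(** An ultrafilter contains a set or its complement, so at each node one summand exceeds its share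
    for [U]-many children: the iterated limit is subadditive. *)
Lemma exceedsD (f g h : seq nat -> K) (B : tree) (F : seq nat) (a b : K) :
  (forall H, h H <= f H + g H) ->
  exceeds h B F (a + b) -> exceeds f B F a \/ exceeds g B F b.
Proof.
move=> hfg; elim: B F => [|c IHc] F /=.
  move=> abh; have := hfg F; case: (ltP a (f F)); [by left|right; lra].
move=> Uh.
have [//|Uf] := in_ultra_setVsetC [set n | exceeds f (c n) (rcons F n) a] U_ultra.
  by left.
right; apply: filterS (filterI Uh Uf) => n [/IHc[]//].
Qed.

Lemma exceeds_scale (f g : seq nat -> K) (B : tree) (F : seq nat) (a C : K) :
  0 < a -> (forall H, g H = a * f H) ->
  exceeds f B F C -> exceeds g B F (a * C).
Proof.
move=> a0 gf; elim: B F => [|b IHb] F /=; first by rewrite gf ltr_pM2l.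
by apply: filterS => n /IHb.
Qed.

(** [A] prescribes [U]-large sets for the next index; an [L] that extends [F] within them descends
    [B] to a leaf, as [B] is well founded. *)
Lemma exceeds_strategy (f : seq nat -> K) (B : tree) (F : seq nat) (C : K) :
  exceeds f B F C -> exists A : seq nat -> set nat, (forall G, U (A G)) /\
    forall L : nat -> nat, mkseq L (size F) = F ->
      (forall i, (size F <= i)%N -> A (mkseq L i) (L i)) ->
    exists m, C < f (mkseq L m).
Proof.
elim: B F => [|b IHb] F /= fC.
  exists (fun=> setT); split=> [G|L LF _]; first exact: filterT.
  by exists (size F); rewrite LF.
have H n : exists A : seq nat -> set nat, (forall G, U (A G)) /\
    (exceeds f (b n) (rcons F n) C -> forall L : nat -> nat,
      mkseq L (size F).+1 = rcons F n ->
      (forall i, (size F < i)%N -> A (mkseq L i) (L i)) ->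
    exists m, C < f (mkseq L m)).
  have [/IHb[A [UA AP]]|nfC] := pselect (exceeds f (b n) (rcons F n) C).
    by exists A; split=> // _; rewrite size_rcons in AP.
  by exists (fun=> setT); split=> // G; exact: filterT.
have [A AP] := choice H.
(* Entry number [size F] is the child taken; later moves read it back from the list and follow that
   child's strategy. *)
exists (fun G => if (size G <= size F)%N then [set n | exceeds f (b n) (rcons F n) C]
  else A (nth 0 G (size F)) G); split=> [G|L LF LA].
  by case: ifP => // _; exact: (AP _).1.
have := LA _ (leqnn _); rewrite size_mkseq leqnn /= => fL.
apply: ((AP _).2 fL L); first by rewrite mkseqS LF.
move=> i Fi; have := LA i (ltnW Fi).
by rewrite size_mkseq leqNgt Fi /= nth_mkseq.
Qed.

Hypothesis U_free : forall k, U [set n | (k <= n)%N].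

Lemma exceeds_unbounded (f : seq nat -> K) :
  (forall F C, exists B, exceeds f B F C) ->
  exists2 p : nat -> nat, increasing_seq p &
    forall q, increasing_seq q -> forall C, exists m, C < f (mkseq (p \o q) m).
Proof.
move=> f_exc.
have strat (x : seq nat * nat) : exists A : seq nat -> set nat, (forall G, U (A G)) /\
    forall L : nat -> nat, mkseq L (size x.1) = x.1 ->
      (forall i, (size x.1 <= i)%N -> A (mkseq L i) (L i)) ->
    exists m, x.2%:R < f (mkseq L m).
  by have [B /exceeds_strategy] := f_exc x.1 x.2%:R.
have [A AP] := choice strat.
(* [D G] obeys the strategies started at all prefixes of [G]; the one started at length [k] aims at
   the bound [k], so a late enough start passes any [C]. *)
pose D G := [set n | forall k : 'I_(size G).+1, A (take k G, val k) G n].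
have [|p p_incr pD] := @ultra_diagonal U D _ U_free.
  by move=> G; apply: filter_forall => k; exact: (AP _).1.
exists p => // q q_incr C.
set L := p \o q; pose k := Num.bound `|C|.
have [|i|m Lm] := (AP (mkseq L k, k)).2 L; first by rewrite size_mkseq.
  rewrite size_mkseq /= => ki.
  have := pD q q_incr i; rewrite /D /=.
  have kL : (k < (size (mkseq L i)).+1)%N by rewrite size_mkseq.
  move=> /(_ (Ordinal kL)) /=.
  by rewrite -map_take take_iota (minn_idPl ki).
exists m; apply: le_lt_trans Lm.
by rewrite (le_trans (ler_norm C))// ltW// archi_boundP.
Qed.

(** Call a list low when no tree exceeds [C] from it. [U]-almost all one-term extensions of a low
    list are low, so lowness persists along the diagonal sequence. *)
Lemma exceeds_bounded (f : seq nat -> K) (C : K) :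
  (forall B, ~ exceeds f B [::] C) ->
  exists2 p : nat -> nat, increasing_seq p &
    forall q, increasing_seq q -> forall m, f (mkseq (p \o q) m) <= C.
Proof.
move=> f_nexc; pose low F := forall B, ~ exceeds f B F C.
pose D F := [set n | low F -> low (rcons F n)].
have [|p p_incr pD] := @ultra_diagonal U D _ U_free.
  move=> F; have [lowF|nlowF] := pselect (low F); last first.
    by apply: filterS filterT => n _ /nlowF.
  have [U_low|U_nlow] := in_ultra_setVsetC [set n | low (rcons F n)] U_ultra.
    by apply: filterS U_low => n + _.
  (* Otherwise the witnessing trees for [U]-many [n] are the children of one [Node] that exceeds [C]
     at [F]. *)
  have H n : exists B, ~ low (rcons F n) -> exceeds f B (rcons F n) C.
    have [?|/existsNP[B /contrapT fB]] := pselect (low (rcons F n)).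
      by exists Leaf.
    by exists B.
  have [b bP] := choice H.
  by case: (lowF (Node b)); apply: filterS U_nlow => n /bP.
exists p => // q q_incr m.
have lowm : low (mkseq (p \o q) m).
  by elim: m => // m IHm; rewrite mkseqS; apply: pD.
by rewrite leNgt; apply/negP; exact: lowm Leaf.
Qed.

End Exceeds.

(** * Banach-Steinhaus for seminorms known only through [p_i v > C] *)

Section UniformBoundedness.
Variables (K : realType) (V : lmodType K) (A : set V) (N : V -> K).
Hypothesis bA : banach_subspace A N.

Lemma banach_subspaceDZ (a : K) v w : A v -> A w -> A (a *: v + w).
Proof.
move=> Av Aw; have [_ /(_ a v w)] := banach_submod bA.
by rewrite !inE; exact.
Qed.

Lemma banach_subspace0 : A 0.
Proof. by have [] := banach_submod bA; rewrite inE. Qed.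

Lemma banach_subspaceZ (a : K) v : A v -> A (a *: v).
Proof.
by move=> Av; rewrite -[_ *: _]addr0; apply/banach_subspaceDZ/banach_subspace0.
Qed.

Lemma banach_subspaceB v w : A v -> A w -> A (v - w).
Proof. by move=> Av Aw; rewrite addrC -scaleN1r; exact: banach_subspaceDZ. Qed.

Lemma banach_normC v w : A v -> A w -> N (v - w) = N (w - v).
Proof.
move=> Av Aw; rewrite -(opprB w v) -(scaleN1r (w - v)) (norm_onZ (banach_norm bA))//.
  by rewrite normrN1 mul1r.
exact: banach_subspaceB.
Qed.

Lemma banach_norm_triangle u v w : A u -> A v -> A w ->
  N (u - w) <= N (u - v) + N (v - w).
Proof.
move=> Au Av Aw; rewrite -[u - w](subrKA v).
by apply: (norm_onD (banach_norm bA)); exact: banach_subspaceB.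
Qed.

(* [P i v C] stands for [p_i v > C], where [p_i] is a seminorm on [A] which
   need not be given as a function. *)
Variables (I : Type) (P : I -> V -> K -> Prop).
Hypothesis P_le : forall i v C C', C' <= C -> P i v C -> P i v C'.
Hypothesis P_add : forall i v w a b, A v -> A w ->
  P i (v + w) (a + b) -> P i v a \/ P i w b.
Hypothesis P_scale : forall i v C a, A v -> a != 0 ->
  P i v C -> P i (a *: v) (`|a| * C).
Hypothesis P_bounded : forall i, exists M, forall v, A v -> N v <= 1 -> ~ P i v M.
Hypothesis P_pointwise : forall v, A v -> exists M, forall i, ~ P i v M.

(** Nested balls: on ball [k.+1] some [p_i] exceeds [k], and completeness gives a point common to
    all balls, where the [p_i] are unbounded. *)
Lemma uniform_boundedness :
  exists M, forall i v, A v -> N v <= 1 -> ~ P i v M.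
Proof.
apply: contrapT => unbounded.
have P_large M : exists i v, [/\ A v, N v <= 1 & P i v M].
  apply: contrapT => H; apply: unbounded; exists M => i v Av Nv Pv.
  by apply: H; exists i, v.
pose refines (k : nat) (x y : V * K) :=
  [/\ A y.1, 0 < y.2, y.2 <= k.+1%:R^-1, N (y.1 - x.1) + y.2 <= x.2 &
    exists i, forall z, A z -> N (z - y.1) <= y.2 -> P i z k%:R].
have step (kx : nat * (V * K)) : exists y,
    A kx.2.1 -> 0 < kx.2.2 -> refines kx.1 kx.2 y.
  case: kx => k [x e] /=; have [[Ax e0]|] := pselect (A x /\ 0 < e); last first.
    by move=> nAe; exists (x, e) => Ax e0; case: nAe.
  have [i [v [Av Nv Pv]]] := P_large (2 / e * k.+1%:R).
  (* [x + (e / 2) v] and [x - (e / 2) v] differ by [e v], where [p_i] exceeds [2 (k + 1)], so [p_i]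
     exceeds [k + 1] at one of them. *)
  have [y [Ay Ny Py]] : exists y, [/\ A y, N (y - x) <= e / 2 & P i y k.+1%:R].
    have Nhalf (a : K) : `|a| = e / 2 -> N (a *: v) <= e / 2.
      by move=> ae; rewrite (norm_onZ (banach_norm bA))// ae ler_piMr//; lra.
    have : P i ((x + (e / 2) *: v) + -1 *: (x - (e / 2) *: v)) (k.+1%:R + k.+1%:R).
      have -> : k.+1%:R + k.+1%:R = `|e| * (2 / e * k.+1%:R).
        by rewrite gtr0_norm//; move: k.+1%:R => c; field; rewrite gt_eqF.
      rewrite scaleN1r opprB [x + _ + _]addrC addrA subrK -scalerDl.
      have -> : e / 2 + e / 2 = e by lra.
      by apply: P_scale => //; rewrite gt_eqF.
    have Ap : A (x + (e / 2) *: v) by rewrite addrC; exact: banach_subspaceDZ.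
    have Am : A (x - (e / 2) *: v).
      by apply: banach_subspaceB => //; exact: banach_subspaceZ.
    move=> /P_add[//||Pp|].
    - exact: banach_subspaceZ.
    - exists (x + (e / 2) *: v); split=> //; rewrite addrAC subrr add0r.
      by apply: Nhalf; rewrite gtr0_norm//; lra.
    - move=> /(@P_scale i _ _ (-1)); rewrite scalerA mulrN1 opprK scale1r normrN1 mul1r.
      rewrite oppr_eq0 oner_eq0 => /(_ (banach_subspaceZ _ Am) isT) Pm.
      exists (x - (e / 2) *: v); split=> //; rewrite addrAC subrr add0r -scaleNr.
      by apply: Nhalf; rewrite normrN gtr0_norm//; lra.
  have [M PM] := P_bounded i.
  pose M' := Num.max 1 M.
  have M'0 : 0 < M' by rewrite lt_max ltr01.
  (* The bound [e / 2] keeps the balls nested, [1 / (k + 1)] makes the centres Cauchy, and [1 / M']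
     lets [p_i] drop by at most [1] on the ball. *)
  exists (y, Num.min (e / 2) (Num.min k.+1%:R^-1 M'^-1)) => _ _ /=; split => //.
  - by rewrite !lt_min !invr_gt0 ltr0Sn M'0 !andbT; lra.
  - by rewrite !ge_min lexx orbT.
  - have : Num.min (e / 2) (Num.min k.+1%:R^-1 M'^-1) <= e / 2 by rewrite ge_min lexx.
    by move: Ny; rewrite /=; lra.
  - exists i => z Az Nz.
    have : P i (z + (y - z)) (k%:R + 1) by rewrite addrC subrK natr1.
    move=> /P_add[//||//|]; first exact: banach_subspaceB.
    move=> /(@P_scale i _ _ M'); rewrite gt_eqF// gtr0_norm// mulr1.
    move=> /(_ (banach_subspaceB Ay Az) isT) Pyz.
    exfalso; apply: (PM (M' *: (y - z))).
    + exact/banach_subspaceZ/banach_subspaceB.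
    + rewrite (norm_onZ (banach_norm bA))//; last exact: banach_subspaceB.
      rewrite gtr0_norm// banach_normC// mulrC -ler_pdivlMr// div1r.
      by apply: le_trans Nz _; rewrite !ge_min lexx !orbT.
    + by apply: P_le Pyz; rewrite le_max lexx orbT.
have [next nextP] := choice step.
pose x := fix x k := if k is k'.+1 then next (k', x k') else (0, 1).
have x_ok k : A (x k).1 /\ 0 < (x k).2.
  elim: k => [|k [Ax x0]]; first by split=> //; exact: banach_subspace0.
  by have [] := nextP (k, x k) Ax x0.
have xA k : A (x k).1 := (x_ok k).1.
have xS k : refines k (x k) (x k.+1) := nextP (k, x k) (xA k) (x_ok k).2.
have Nxx v : N (v - v) = 0.
  by rewrite subrr -(scale0r (0 : V)) (norm_onZ (banach_norm bA)) ?normr0 ?mul0r//;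
    exact: banach_subspace0.
have nested n m : (n <= m)%N -> N ((x m).1 - (x n).1) + (x m).2 <= (x n).2.
  elim: m => [|m IHm]; first by rewrite leqn0 => /eqP ->; rewrite Nxx add0r.
  rewrite leq_eqVlt => /predU1P[->|/IHm mn]; first by rewrite Nxx add0r.
  have [_ _ _ Sm _] := xS m.
  have := banach_norm_triangle (xA m.+1) (xA m) (xA n).
  by move: mn Sm; lra.
have close n m : (n <= m)%N -> N ((x m).1 - (x n).1) <= (x n).2.
  by move=> /nested; have := (x_ok m).2; lra.
have cauchy (e : K) : 0 < e -> exists n0 : nat, forall m n : nat,
    (n0 <= m)%N -> (n0 <= n)%N -> N ((x m).1 - (x n).1) < e.
  move=> e0; pose n0 := Num.bound (2 / e); exists n0.+1 => m n nm nn.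
  have [_ _ small _ _] := xS n0.
  have {}small : (x n0.+1).2 < e / 2.
    apply: le_lt_trans small _.
    rewrite -[e / 2]invf_div ltf_pV2 ?posrE ?divr_gt0 ?ltr0Sn//.
    have /lt_trans : 2 / e < n0%:R by rewrite archi_boundP// divr_ge0// ltW.
    by apply; rewrite ltr_nat.
  have := banach_norm_triangle (xA m) (xA n0.+1) (xA n).
  rewrite (banach_normC (xA n0.+1) (xA n)).
  move: (close _ _ nm) (close _ _ nn) small; lra.
have [v Av xv] := banach_complete bA xA cauchy.
have ball n : N (v - (x n).1) <= (x n).2.
  apply/ler_addgt0Pr => e e0.
  have /(_ _ e e0) xv_lt := (cvgrPdist_lt _ _).1 xv.
  have [m [/= vm nm]] := filter_ex (filterI xv_lt (nbhs_infty_ge n)).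
  have := banach_norm_triangle Av (xA m) (xA n); rewrite (banach_normC Av (xA m)).
  have := close _ _ nm; have := ler_norm (- (0 - N ((x m).1 - v))).
  by rewrite normrN; move: vm; lra.
have [M MP] := P_pointwise Av.
have [_ _ _ _ [i Pi]] := xS (Num.bound `|M|).
apply: (MP i); apply: P_le (Pi _ Av (ball _.+1)).
by rewrite (le_trans (ler_norm M))// ltW// archi_boundP.
Qed.

End UniformBoundedness.

(** * Values of [s] on finite pieces of a sequence *)

Section PartialNorm.
Variables (K : realType) (X : completeNormedModType K) (s : (nat -> X) -> K).
Hypothesis hs : bimonotone_norm s.
Let s_norm := bimonotone_is_norm hs.

Lemma c00_closed : submod_closed (mem (@c00 K X)).
Proof.
split; first by rewrite inE => A [[A0 _] _]; rewrite inE in A0.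
move=> a v w; rewrite !inE => cv cw A hA.
by have [[_ /(_ a v w)]] := hA; rewrite !inE => + _; apply; [exact: cv|exact: cw].
Qed.

Lemma c00_tensor (x : X) n : c00 (tensor x n).
Proof. by move=> A [_]; apply; exists (x, n). Qed.

Lemma c00D (v w : nat -> X) : c00 v -> c00 w -> c00 (v + w).
Proof.
move=> cv cw; have [_ /(_ 1 v w)] := c00_closed.
by rewrite !inE scale1r; exact.
Qed.

Lemma c00Z (a : K) (v : nat -> X) : c00 v -> c00 (a *: v).
Proof.
move=> cv; have [c0 /(_ a v 0)] := c00_closed.
by rewrite !inE addr0 in c0 *; exact.
Qed.

Lemma c00_sum (I : Type) (l : seq I) (F : I -> nat -> X) :
  (forall i, c00 (F i)) -> c00 (\sum_(i <- l) F i).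
Proof.
move=> cF; elim/big_rec: _ => [|i v _]; last exact: c00D.
by have [] := c00_closed; rewrite inE.
Qed.

Lemma tensorD (x y : X) n : tensor (x + y) n = tensor x n + tensor y n.
Proof.
apply/funext => k; rewrite /tensor [RHS]/=.
by rewrite /GRing.add /=; case: ifP; rewrite ?addr0.
Qed.

Lemma tensorZ (a : K) (x : X) n : tensor (a *: x) n = a *: tensor x n.
Proof.
apply/funext => k; rewrite /tensor.
by rewrite [RHS]/GRing.scale /=; case: ifP; rewrite ?scaler0.
Qed.

(** The offset [k] places a tail behind an earlier piece, so that concatenation becomes a sum. *)
Definition tensors (sigma : nat -> X) (F : seq nat) (k : nat) : nat -> X :=
  \sum_(i < size F) tensor (sigma (nth 0%N F i)) (k + i).

Definition partial_norm (sigma : nat -> X) (F : seq nat) : K :=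
  s (tensors sigma F 0).

Lemma c00_tensors sigma F k : c00 (tensors sigma F k).
Proof. by apply: c00_sum => i; exact: c00_tensor. Qed.

Lemma tensors_cat sigma F G :
  tensors sigma (F ++ G) 0 = tensors sigma F 0 + tensors sigma G (size F).
Proof.
rewrite /tensors size_cat big_split_ord /=; congr (_ + _).
  by apply: eq_bigr => i _; rewrite nth_cat ltn_ord.
by apply: eq_bigr => i _; rewrite nth_cat ltnNge leq_addr /= addKn add0n.
Qed.

Lemma partial_normD sigma tau F :
  partial_norm (sigma + tau) F <= partial_norm sigma F + partial_norm tau F.
Proof.
have -> : partial_norm (sigma + tau) F = s (tensors sigma F 0 + tensors tau F 0).
  by congr s; rewrite /tensors -big_split; apply: eq_bigr => i _; exact: tensorD.
by apply: (norm_onD s_norm); exact: c00_tensors.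
Qed.

Lemma partial_normZ a sigma F :
  partial_norm (a *: sigma) F = `|a| * partial_norm sigma F.
Proof.
rewrite -(norm_onZ s_norm); last exact: c00_tensors.
by congr s; rewrite /tensors scaler_sumr; apply: eq_bigr => i _; exact: tensorZ.
Qed.

Lemma bimonotone_norm0 : s 0 = 0.
Proof.
rewrite -(scale0r (tensor (0 : X) 0)) (norm_onZ s_norm) ?normr0 ?mul0r//.
exact: c00_tensor.
Qed.

Lemma partial_norm_le (beta : K) sigma F :
  (forall n, `|sigma n| <= beta) -> partial_norm sigma F <= (size F)%:R * beta.
Proof.
move=> sb; rewrite /partial_norm /tensors mulr_natl.
suff : forall n (x : nat -> X), (forall i, `|x i| <= beta) ->
    s (\sum_(i < n) tensor (x i) i) <= beta *+ n.
  by move=> /(_ (size F) (fun i => sigma (nth 0%N F i))); apply.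
move=> n x xb; elim: n => [|n IHn]; first by rewrite big_ord0 bimonotone_norm0.
rewrite big_ord_recr /= mulrSr (le_trans (norm_onD s_norm _ _))//.
- by apply: c00_sum => i; exact: c00_tensor.
- exact: c00_tensor.
- by rewrite lerD// (bimonotone_tensor hs).
Qed.

(** Prefixes of equal length leave [H] at the same positions, so the two pieces differ only in the
    prefixes, whose norms are at most [size F] times [beta]. *)
Lemma partial_norm_shift (beta : K) sigma F G H :
    (forall n, `|sigma n| <= beta) -> size F = size G ->
  partial_norm sigma (F ++ H) <=
    partial_norm sigma (G ++ H) + 2 * (size F)%:R * beta.
Proof.
move=> sb FG; rewrite /partial_norm !tensors_cat FG.
set v := tensors sigma F 0; set w := tensors sigma G 0; set z := tensors _ _ _.
have sv : s v <= (size G)%:R * beta by rewrite -FG; exact: partial_norm_le.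
have sw : s w <= (size G)%:R * beta by exact: partial_norm_le.
have cw : c00 (-1 *: w) by apply: c00Z; exact: c00_tensors.
have -> : v + z = (w + z) + (v + -1 *: w).
  by rewrite scaleN1r [RHS]addrC addrA subrK.
have := norm_onD s_norm (c00D (c00_tensors _ _ _) (c00_tensors _ _ _) : c00 (w + z))
  (c00D (c00_tensors _ _ _) cw : c00 (v + -1 *: w)).
have := norm_onD s_norm (c00_tensors _ _ _ : c00 v) cw.
rewrite (norm_onZ s_norm _ (c00_tensors _ _ _ : c00 w)) normrN1 mul1r; lra.
Qed.

Lemma block_partial_norm sigma (f : nat -> nat) m :
  s (block 0 m (sigma \o f)) = partial_norm sigma (mkseq f m.+1).
Proof.
rewrite /partial_norm /tensors /block size_mkseq big_mkord; congr s.
by apply: eq_bigr => i _; rewrite nth_mkseq.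
Qed.

Variable U : set_system nat.
Context {U_ultra : UltraFilter U}.

(** Up to this error, prefixes of the same length are interchangeable; prepending [size F] constant
    nodes to [B] would then give a tree exceeding [C] at the root. *)
Lemma not_exceeds_prefix (beta C : K) sigma F B :
    (forall n, `|sigma n| <= beta) ->
    (forall T, ~ exceeds U (partial_norm sigma) T [::] C) ->
  ~ exceeds U (partial_norm sigma) B F (C + 2 * (size F)%:R * beta).
Proof.
move=> sb nexc exc.
have {exc} : forall G, size G = size F -> exceeds U (partial_norm sigma) B G C.
  move=> G GF; apply: exceeds_shift exc => H; exact: partial_norm_shift.
elim: (size F) B => [|k IHk] B excB; first exact: (nexc B (excB [::] erefl)).
apply: (IHk (Node (fun=> B))) => G Gk /=.
by apply: filterS filterT => n _; apply: excB; rewrite size_rcons Gk.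
Qed.

(** Descending through a tree that exceeds a large enough bound reaches some list as long as [F],
    which is then exchanged for [F]. *)
Lemma exceeds_prefix (beta : K) sigma :
    (forall n, `|sigma n| <= beta) ->
    (forall C, exists B, exceeds U (partial_norm sigma) B [::] C) ->
  forall F C, exists B, exceeds U (partial_norm sigma) B F C.
Proof.
move=> sb exc F C.
have deep k : forall c, exists G B,
    size G = k /\ exceeds U (partial_norm sigma) B G c.
  elim: k => [|k IHk] c; first by have [B ?] := exc c; exists [::], B.
  (* The bound [k%:R * beta] rules out [Leaf]: no piece of length [k] has a larger norm. *)
  have [G [[|b] [Gk /= Gexc]]] := IHk (Num.max c (k%:R * beta)).
    have := partial_norm_le G sb; rewrite Gk leNgt => /negP[].
    by apply: le_lt_trans Gexc; rewrite le_max lexx orbT.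
  have [n nexc] := filter_ex Gexc.
  exists (rcons G n), (b n); rewrite size_rcons Gk; split=> //.
  by apply: exceeds_le nexc; rewrite le_max lexx.
have [G [B [GF Bexc]]] := deep (size F) (C + 2 * (size F)%:R * beta).
exists B; apply: exceeds_shift Bexc => H.
by rewrite -GF; exact: partial_norm_shift.
Qed.

(** * Subsequential spaces *)

Variables (R : set (nat -> X)) (r : (nat -> X) -> K).
Hypothesis hR : subsequential_space R r.
Let bR := subseq_banach hR.

(** Serves twice: for the children of one node, and for all trees at the root. *)
Lemma exceeds_uniform_boundedness (I : Type) (T : I -> tree) (F : I -> seq nat) :
    (forall i, exists M, forall sigma, R sigma -> r sigma <= 1 ->
      ~ exceeds U (partial_norm sigma) (T i) (F i) M) ->
    (forall sigma, R sigma -> exists M, forall i,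
      ~ exceeds U (partial_norm sigma) (T i) (F i) M) ->
  exists M, forall i sigma, R sigma -> r sigma <= 1 ->
    ~ exceeds U (partial_norm sigma) (T i) (F i) M.
Proof.
pose P i sigma C := exceeds U (partial_norm sigma) (T i) (F i) C.
move=> bnd ptw; apply: (uniform_boundedness bR (P := P)) => //.
- by move=> i v C C'; exact: exceeds_le.
- by move=> i v w a b _ _; apply: exceedsD => H; exact: partial_normD.
- move=> i v C a _ a0; apply: exceeds_scale; first by rewrite normr_gt0.
  by move=> H; exact: partial_normZ.
Qed.

Lemma subsequential_bounded sigma : R sigma ->
  exists beta, forall n, `|sigma n| <= beta.
Proof.
move=> /(subseq_linf hR) [M [_ bnd]]; exists (M + 1) => n.
by apply: bnd => //; rewrite ltrDl.
Qed.

Lemma subsequential_ball_le1 sigma n : R sigma -> r sigma <= 1 -> `|sigma n| <= 1.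
Proof.
move=> Rs rs; have [_] := subseq_ball hR (conj Rs rs).
apply: le_trans; apply: ub_le_sup; last by exists n.
have [beta sb] := subsequential_bounded Rs.
by exists beta => _ [k _ <-].
Qed.

Lemma subsequential_scale sigma : R sigma -> exists2 a : K, 0 < a &
  closed_ball_on R r 1 (a *: sigma).
Proof.
move=> Rs; have r0 := norm_on_ge0 (banach_norm bR) Rs.
have r1 : 0 < r sigma + 1 by lra.
exists (r sigma + 1)^-1; rewrite ?invr_gt0//; split.
  exact: banach_subspaceZ bR _ _ _.
rewrite (norm_onZ (banach_norm bR))// gtr0_norm ?invr_gt0//.
by rewrite mulrC ler_pdivrMr// mul1r lerDl.
Qed.

Lemma subsequential_subsequence sigma tau :
  R sigma -> subsequence tau sigma -> R tau.
Proof.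
move=> Rs [f f_incr ->]; have [a a0 Ba] := subsequential_scale Rs.
have [Ra _] : closed_ball_on R r 1 ((a *: sigma) \o f).
  by apply: (subseq_stable hR Ba); exists f.
have -> : sigma \o f = a^-1 *: ((a *: sigma) \o f).
  by apply/funext => n /=; rewrite [RHS]/GRing.scale /= scalerA mulVf ?scale1r// gt_eqF.
exact: banach_subspaceZ bR _ _ _.
Qed.

Lemma natural_ballP C sigma :
  closed_ball_on (natural_domain s) (natural_ext s) C sigma <->
  linf sigma /\ forall m, s (block 0 m sigma) <= C.
Proof.
split=> [[[sl sub] sC]|[sl sC]].
  by split=> // m; apply: le_trans sC; apply: ub_le_sup => //; exists m.
split; first by split=> //; exists C => _ [m _ <-].
by apply: ge_sup => [|_ [m _ <-]//]; exists (s (block 0 0 sigma)), 0%N.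
Qed.

(** * Uniform bounds from statement (1) *)

Hypothesis U_free : forall k, U [set n | (k <= n)%N].
Hypothesis R_sub_natural : forall sigma, R sigma ->
  exists2 rho, subsequence rho sigma & natural_domain s rho.

(** Otherwise diagonalisation yields a subsequence of [sigma], still in [R], none of whose
    subsequences is in the natural domain, against [R_sub_natural]. *)
Lemma exceeds_pointwise sigma : R sigma ->
  exists C, forall B, ~ exceeds U (partial_norm sigma) B [::] C.
Proof.
move=> Rs; apply: contrapT => unb.
have [beta sb] := subsequential_bounded Rs.
have [|p p_incr pP] := exceeds_unbounded U_free (exceeds_prefix sb _).
  move=> C; apply: contrapT => nexc; apply: unb; exists C => B exc.
  by apply: nexc; exists B.
have [|_ [q q_incr ->] [_ [C ubC]]] := @R_sub_natural (sigma \o p).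
  by apply: subsequential_subsequence Rs _; exists p.
(* Blocks are nonempty, so the empty piece must be excluded: its norm [0] is not above
   [Num.max C 0]. *)
have [[|m]] := pP q q_incr (Num.max C 0).
  by rewrite /partial_norm /tensors big_ord0 bimonotone_norm0 gt_max ltxx andbF.
rewrite -block_partial_norm gt_max => /andP[+ _].
by rewrite ltNge ubC//; exists m.
Qed.

(* The trees being well-founded, Banach-Steinhaus along the branches gives a
   bound for each of them. *)
Lemma exceeds_tree_bounded B F : exists M, forall sigma, R sigma -> r sigma <= 1 ->
  ~ exceeds U (partial_norm sigma) B F M.
Proof.
elim: B F => [|b IHb] F /=.
  exists ((size F)%:R * 1) => sigma Rs rs; apply/negP; rewrite -leNgt.
  by apply: partial_norm_le => n; exact: subsequential_ball_le1.
have [M MP] : exists M, forall n sigma, R sigma -> r sigma <= 1 ->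
    ~ exceeds U (partial_norm sigma) (b n) (rcons F n) M.
  apply: exceeds_uniform_boundedness => [n|sigma Rs]; first exact: IHb.
  have [C CP] := exceeds_pointwise Rs.
  have [beta sb] := subsequential_bounded Rs.
  (* All [rcons F n] have the same length, so this bound does not depend on [n]. *)
  exists (C + 2 * (size F).+1%:R * beta) => n.
  by rewrite -(size_rcons F n); exact: not_exceeds_prefix.
by exists M => sigma Rs rs /filter_ex[n]; exact: MP.
Qed.

(** Each tree has its own bound on the ball, and all trees share a bound at each point;
    Banach-Steinhaus gives one [C], which [exceeds_bounded] turns into subsequences. *)
Lemma natural_ball_uniform : exists C, forall sigma, closed_ball_on R r 1 sigma ->
  exists2 rho, subsequence rho sigma & forall tau, subsequence tau rho ->
    closed_ball_on (natural_domain s) (natural_ext s) C tau.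
Proof.
have [|sigma /exceeds_pointwise//|C CP] :=
  @exceeds_uniform_boundedness tree id (fun=> [::]).
  by move=> B; exact: exceeds_tree_bounded.
exists C => sigma [Rs rs].
have [p p_incr pP] := exceeds_bounded U_free (fun B => CP B sigma Rs rs).
exists (sigma \o p); first by exists p.
move=> _ [q q_incr ->]; apply/natural_ballP; split.
  apply/(subseq_linf hR)/(subsequential_subsequence Rs).
  by exists (p \o q) => //; exact: increasing_seq_comp.
by move=> m; rewrite -compA block_partial_norm; exact: pP.
Qed.

End PartialNorm.

Theorem theorem1p3 (K : realType) (X : completeNormedModType K)
    (R : set (nat -> X)) (r s : (nat -> X) -> K)
    (hR : subsequential_space R r) (hs : bimonotone_norm s) :
  let S := natural_domain s in
  let CB (C : K) := closed_ball_on S (natural_ext s) C in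
  [<-> (* (1) *)
       forall sigma, R sigma -> exists2 rho, subsequence rho sigma & S rho;
       (* (2) *)
       forall sigma, R sigma -> exists C : K,
         exists2 rho, subsequence rho sigma &
           forall tau, subsequence tau rho -> CB C tau;
       (* (3) *)
       exists C : K, forall sigma, closed_ball_on R r 1 sigma ->
         exists2 rho, subsequence rho sigma &
           forall tau, subsequence tau rho -> CB C tau].
Proof.
move=> S CB.
pose P1 := forall sigma, R sigma -> exists2 rho, subsequence rho sigma & S rho.
pose P2 := forall sigma, R sigma -> exists C : K,
  exists2 rho, subsequence rho sigma & forall tau, subsequence tau rho -> CB C tau.
pose P3 := exists C : K, forall sigma, closed_ball_on R r 1 sigma ->
  exists2 rho, subsequence rho sigma & forall tau, subsequence tau rho -> CB C tau.
have P21 : P2 -> P1.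
  move=> p2 sigma /p2[C [rho rho_sub rhoC]]; exists rho => //.
  by have [] : CB C rho by apply: rhoC; exists id.
have P13 : P1 -> P3.
  have [U U_ultra U_free] := free_ultrafilter.
  exact: (natural_ball_uniform hs hR U_free).
have P32 : P3 -> P2.
  move=> [C CP] sigma Rs.
  have [a a0 /CP[_ [p p_incr ->] rhoP]] := subsequential_scale hR Rs.
  (* [C] is rescaled since [sigma] is [a^-1] times a member of the unit ball. *)
  exists (a^-1 * C), (sigma \o p); first by exists p.
  move=> _ [q q_incr ->]; apply/natural_ballP; split.
    apply/(subseq_linf hR)/(subsequential_subsequence hR Rs).
    by exists (p \o q) => //; exact: increasing_seq_comp.
  have /natural_ballP[_ tauC] : CB C ((a *: sigma) \o p \o q) by apply: rhoP; exists q.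
  move=> m; have -> : s (block 0 m ((sigma \o p) \o q)) =
      partial_norm s sigma (mkseq (p \o q) m.+1)
    by exact: (block_partial_norm s sigma (p \o q) m).
  have : partial_norm s (a *: sigma) (mkseq (p \o q) m.+1) <= C.
    by rewrite -block_partial_norm; exact: tauC.
  by rewrite (partial_normZ hs) gtr0_norm// ler_pdivlMl.
(* The implications proved are (1) to (3), (3) to (2) and (2) to (1); the required cycle runs the
   other way, so each of its steps composes two of them. *)
tfae.
- by move=> /P13/P32.
- by move=> /P21/P13.
- by move=> /P32/P21.
Qed.
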